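(* Let $\mathcal{M}=(X,rk,m)$ be an arithmetic matroid with underlying matroid $M=(X,rk)$. Then $$\chi_{\mathcal{M}}(\lambda\xi)=\sum_{A\subseteq X}\lambda^{rk(X)-rk(A)}\,\chi_{\mathcal{M}|A}(\lambda)\,\chi_{M/A}(\xi)$$ and $$\chi_{\mathcal{M}}(\lambda\xi)=\sum_{A\subseteq X}\lambda^{rk(X)-rk(A)}\,\chi_{M|A}(\lambda)\,\chi_{\mathcal{M}/A}(\xi).$$
   Context: A matroid $(X,rk)$ is given by a finite ground set $X$ and its rank function $rk$. A multiplicity matroid is a triple $\mathcal{M}=(X,rk,m)$ where $(X,rk)$ is a matroid and $m:2^X\to\mathbb{Z}_{>0}$ is any function. It is an arithmetic matroid if $m$ satisfies: (1) for all $A\subseteq X$ and $e\in X$: if $rk(A\cup\{e\})=rk(A)$ then $m(A\cup\{e\})$ divides $m(A)$; otherwise $m(A)$ divides $m(A\cup\{e\})$; (2) if $A\subseteq B\subseteq X$ and $B$ is a disjoint union $B=A\cup F\cup T$ such that $rk(C)=rk(A)+|C\cap F|$ for all $A\subseteq C\subseteq B$, then $m(A)m(B)=m(A\cup F)m(A\cup T)$; (3) if $A\subseteq B\subseteq X$ and $rk(A)=rk(B)$, then $\sum_{A\subseteq T\subseteq B}(-1)^{|T|-|A|}m(T)\ge 0$; (4) if $A\subseteq B\subseteq X$ and $rk^*(A)=rk^*(B)$, then $\sum_{A\subseteq T\subseteq B}(-1)^{|T|-|A|}m(X\setminus T)\ge 0$, where $rk^*(A)=|A|+rk(X\setminus A)-rk(X)$.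 For $T\subseteq X$, the restriction $\mathcal{M}|T$ is the multiplicity matroid on $T$ obtained by restricting $rk$ and $m$ to subsets of $T$. The contraction $\mathcal{M}/T$ is the multiplicity matroid on $X\setminus T$ with $rk_{\mathcal{M}/T}(A)=rk(A\cup T)-rk(T)$ and $m_{\mathcal{M}/T}(A)=m(A\cup T)$ for $A\subseteq X\setminus T$. $M|T$ and $M/T$ are the usual matroid restriction and contraction, i.e. the underlying matroids of $\mathcal{M}|T$ and $\mathcal{M}/T$. Let $\lambda,\xi$ be commuting variables. The characteristic polynomial of $\mathcal{M}$ and the (classical) characteristic polynomial of $M$ are $$\chi_{\mathcal{M}}(\lambda)=\sum_{A\subseteq X}(-1)^{|A|}m(A)\,\lambda^{rk(X)-rk(A)},\qquad \chi_{M}(\lambda)=\sum_{A\subseteq X}(-1)^{|A|}\lambda^{rk(X)-rk(A)}.$$ For a restriction or contraction, the same formulas are used with its own ground set, rank function and (if present) multiplicity. *)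

(* Defs.v *)
From HB Require Import structures.
From mathcomp Require Import all_boot all_order all_algebra.
Set Implicit Arguments.
Unset Strict Implicit.
Unset Printing Implicit Defensive.
Import Order.TTheory GRing.Theory Num.Theory.
Local Open Scope ring_scope.

(* The ground set is the whole finite type [X]; consequently the ground set of *)
(* a restriction or contraction is the corresponding subtype of [X].           *)
Record matroid (X : finType) := Matroid {
  rk : {set X} -> nat;
  rk_le_card : forall A, (rk A <= #|A|)%N;
  rk_mono : forall A B : {set X}, A \subset B -> (rk A <= rk B)%N;
  rk_submod : forall A B : {set X}, (rk (A :|: B) + rk (A :&: B) <= rk A + rk B)%N
}.

Record mult_matroid (X : finType) := MultMatroid {
  underlying :> matroid X;
  mult : {set X} -> nat;
  mult_gt0 : forall A, (0 < mult A)%N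
}.

(* The truncated subtraction is exact: [rk setT <= rk (~: A) + #|A|]. *)
Definition corank (X : finType) (M : matroid X) (A : {set X}) : nat :=
  (#|A| + rk M (~: A) - rk M setT)%N.

Record arithmetic (X : finType) (M : mult_matroid X) : Prop := Arithmetic {
  arith_dvd : forall (A : {set X}) (e : X),
    if rk M (e |: A) == rk M A then (mult M (e |: A) %| mult M A)%N
    else (mult M A %| mult M (e |: A))%N;
  arith_molecule : forall A B F T : {set X},
    A \subset B -> B = A :|: F :|: T ->
    [disjoint A & F] -> [disjoint A & T] -> [disjoint F & T] ->
    (forall C : {set X}, A \subset C -> C \subset B ->
       rk M C = (rk M A + #|C :&: F|)%N) ->
    (mult M A * mult M B = mult M (A :|: F) * mult M (A :|: T))%N;
  arith_pos : forall A B : {set X},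
    A \subset B -> rk M A = rk M B ->
    0 <= \sum_(T : {set X} | (A \subset T) && (T \subset B))
           (-1) ^+ (#|T| - #|A|) * (mult M T)%:Z;
  arith_pos_dual : forall A B : {set X},
    A \subset B -> corank M A = corank M B ->
    0 <= \sum_(T : {set X} | (A \subset T) && (T \subset B))
           (-1) ^+ (#|T| - #|A|) * (mult M (~: T))%:Z
}.

Definition restr_type (X : finType) (T : {set X}) : finType :=
  {x : X | x \in T}.
Definition contr_type (X : finType) (T : {set X}) : finType :=
  {x : X | x \in ~: T}.

Section Minors.
Variables (X : finType) (T : {set X}).

Definition restr_set (A : {set restr_type T}) : {set X} := [set val x | x in A].
Definition contr_set (A : {set contr_type T}) : {set X} := [set val x | x in A].

Variable M : matroid X.

Definition restr_rk (A : {set restr_type T}) : nat := rk M (restr_set A).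
Definition contr_rk (A : {set contr_type T}) : nat :=
  (rk M (contr_set A :|: T) - rk M T)%N.

Lemma restr_rk_le_card A : (restr_rk A <= #|A|)%N.
Proof. by rewrite -(card_imset _ val_inj); apply: rk_le_card. Qed.

Lemma restr_rk_mono (A B : {set restr_type T}) :
  A \subset B -> (restr_rk A <= restr_rk B)%N.
Proof. by move=> sAB; apply/rk_mono/imsetS. Qed.

Lemma restr_rk_submod A B :
  (restr_rk (A :|: B) + restr_rk (A :&: B) <= restr_rk A + restr_rk B)%N.
Proof.
rewrite /restr_rk /restr_set imsetU imsetI; first exact: rk_submod.
by move=> x y _ _; apply: val_inj.
Qed.

Lemma contr_rk_le_card A : (contr_rk A <= #|A|)%N.
Proof.
rewrite -(card_imset _ val_inj) leq_subLR addnC.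
apply: leq_trans (leq_addr _ _) (leq_trans (rk_submod M _ _) _).
by rewrite leq_add2r rk_le_card.
Qed.

Lemma contr_rk_mono (A B : {set contr_type T}) :
  A \subset B -> (contr_rk A <= contr_rk B)%N.
Proof. by move=> sAB; apply/leq_sub2r/rk_mono/setSU/imsetS. Qed.

Lemma contr_rk_submod A B :
  (contr_rk (A :|: B) + contr_rk (A :&: B) <= contr_rk A + contr_rk B)%N.
Proof.
have le C : (rk M T <= rk M (contr_set C :|: T))%N by apply/rk_mono/subsetUr.
rewrite -(leq_add2r (rk M T + rk M T)) addnACA (addnACA (contr_rk A)).
rewrite /contr_rk !subnK //.
have -> : contr_set (A :|: B) :|: T = (contr_set A :|: T) :|: (contr_set B :|: T).
  by rewrite /contr_set imsetU setUACA setUid.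
have -> : contr_set (A :&: B) :|: T = (contr_set A :|: T) :&: (contr_set B :|: T).
  rewrite /contr_set imsetI ?setUIl //.
  by move=> x y _ _; apply: val_inj.
exact: rk_submod.
Qed.

Definition restr : matroid (restr_type T) :=
  Matroid restr_rk_le_card restr_rk_mono restr_rk_submod.

Definition contr : matroid (contr_type T) :=
  Matroid contr_rk_le_card contr_rk_mono contr_rk_submod.

End Minors.

Section MultMinors.
Variables (X : finType) (T : {set X}) (M : mult_matroid X).

Definition mrestr : mult_matroid (restr_type T) :=
  @MultMatroid _ (restr T M) (fun A => mult M (restr_set A))
    (fun A => mult_gt0 M (restr_set A)).

Definition mcontr : mult_matroid (contr_type T) :=
  @MultMatroid _ (contr T M) (fun A => mult M (contr_set A :|: T))
    (fun A => mult_gt0 M (contr_set A :|: T)).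

End MultMinors.

Definition chi (X : finType) (M : matroid X) : {poly int} :=
  \sum_(A : {set X}) (-1) ^+ #|A| *: 'X^(rk M setT - rk M A).

Definition mchi (X : finType) (M : mult_matroid X) : {poly int} :=
  \sum_(A : {set X}) ((-1) ^+ #|A| * (mult M A)%:Z) *: 'X^(rk M setT - rk M A).

(* The ring Z[lambda, xi] is represented as Z[lambda][xi]. *)
Definition lambda : {poly {poly int}} := 'X%:P.
Definition xi : {poly {poly int}} := 'X.

Definition eval_at (p : {poly int}) (z : {poly {poly int}}) : {poly {poly int}} :=
  (map_poly intr p).[z].

(* Main.v *)
Require Import Defs.
From HB Require Import structures.
From mathcomp Require Import all_boot all_order all_algebra ring.
Set Implicit Arguments.
Unset Strict Implicit.
Unset Printing Implicit Defensive.
Import Order.TTheory GRing.Theory Num.Theory.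
Local Open Scope ring_scope.

(** Write [r] for the rank of the ground set. The sets of [M | A] are the [B]
    contained in [A], and the sets of [M / A] correspond to the [C] containing
    [A] ([sum_restr], [sum_contr]), so either right-hand side is a sum over
    chains [B \subset A \subset C]. Since [r - rk A + (rk A - rk B) = r - rk B],
    the exponents do not depend on [A], and [A] occurs only in the sign
    [(-1) ^+ #|C :\: A|]. Summed over the Boolean interval between [B] and [C]
    these signs cancel unless [B = C] ([sum_sign_interval]: Moebius inversion
    on the subset lattice), and the chains with [B = C] give the terms in
    [lambda ^+ (r - rk B) * xi ^+ (r - rk B)] of the left-hand side. This
    computation, [rank_convolution], allows arbitrary weights [f] on [B] and
    [g] on [C]; the two identities are the cases where one of the weights is
    the multiplicity and the other is constantly [1]. *)

(** When [B] is a proper subset of [C], toggling an element of [C] outside [B]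
    is a sign-reversing involution of the interval, so the sum is its own
    opposite. *)
Lemma sum_sign_interval (X : finType) (B C : {set X}) : B \subset C ->
  \sum_(A : {set X} | (B \subset A) && (A \subset C)) (-1) ^+ #|C :\: A|
    = (B == C)%:R :> int.
Proof.
move=> sBC; case: eqVneq => [<-|neqBC].
  rewrite (big_pred1 B) ?setDv ?cards0 // => A.
  by rewrite /= eqEsubset andbC.
have /properP[_ [x xC xNB]] : B \proper C by rewrite properEneq neqBC.
pose tog (A : {set X}) := if x \in A then A :\ x else x |: A.
have togK : involutive tog.
  move=> A; rewrite /tog; case: (boolP (x \in A)) => xA.
    by rewrite setD11 setD1K.
  by rewrite setU11 setU1K.
apply/eqP; rewrite -eqNr; apply/eqP.
rewrite [RHS](reindex_inj (inv_inj togK)) -sumrN /=.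
apply: eq_big => [A | A _]; rewrite /tog; case: ifPn => xA.
- rewrite subsetD1 xNB andbT; congr (_ && _).
  by rewrite -{1}(setD1K xA) subUset sub1set xC.
- rewrite subUset sub1set xC /=; congr (_ && _).
  by rewrite -{1}(setU1K xA) subsetD1 xNB andbT.
- have -> : C :\: (A :\ x) = x |: (C :\: A).
    by apply/setP=> z; rewrite !inE; case: eqP => [->|]; rewrite ?xC.
  by rewrite cardsU1 !inE xA /= exprS mulN1r.
- have -> : C :\: A = x |: (C :\: (x |: A)).
    by apply/setP=> z; rewrite !inE; case: eqP => [->|]; rewrite ?xC ?xA.
  by rewrite cardsU1 !inE eqxx /= exprS mulN1r opprK.
Qed.

(** Exchanging the sums isolates the sum over [A] between fixed [B] and [C],
    which is the Kronecker delta of [B] and [C]; the weights [f] and [g] then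
    meet at the same set. *)
Lemma rank_convolution (R : comNzRingType) (X : finType) (M : matroid X)
    (f g : {set X} -> R) (x y : R) :
  \sum_(A : {set X}) x ^+ (rk M setT - rk M A) *
     (\sum_(B : {set X} | B \subset A)
        (-1) ^+ #|B| * f B * x ^+ (rk M A - rk M B)) *
     (\sum_(C : {set X} | A \subset C)
        (-1) ^+ #|C :\: A| * g C * y ^+ (rk M setT - rk M C))
  = \sum_(A : {set X})
      (-1) ^+ #|A| * f A * g A * (x * y) ^+ (rk M setT - rk M A).
Proof.
set r := rk M setT.
pose t (B C : {set X}) : R := (-1) ^+ #|B| * f B * g C *
  (x ^+ (r - rk M B) * y ^+ (r - rk M C)).
transitivity (\sum_(A : {set X}) \sum_(B : {set X} | B \subset A)
    \sum_(C : {set X} | A \subset C) t B C * (-1) ^+ #|C :\: A|).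
  apply: eq_bigr => A _; rewrite -mulrA mulr_suml mulr_sumr.
  apply: eq_bigr => B sBA; rewrite !mulr_sumr; apply: eq_bigr => C _.
  (* The exponent [r - rk M B] splits at [rk M A], as [B \subset A]. *)
  have -> : t B C = (-1) ^+ #|B| * f B * g C *
      (x ^+ (r - rk M A) * x ^+ (rk M A - rk M B) * y ^+ (r - rk M C)).
    by rewrite -exprD addnBA ?rk_mono // subnK // rk_mono ?subsetT.
  by ring.
rewrite (exchange_big_dep predT) //=; apply: eq_bigr => B _.
rewrite (exchange_big_dep (fun C : {set X} => B \subset C)) /=; last first.
  by move=> A C sBA; apply: subset_trans.
have sumA (C : {set X}) : B \subset C ->
    \sum_(A : {set X} | (B \subset A) && (A \subset C))
       t B C * (-1) ^+ #|C :\: A| = t B C * (B == C)%:R.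
  move=> sBC; rewrite -mulr_sumr; congr (_ * _).
  rewrite -(rmorph_nat (intr : {rmorphism int -> R})) -sum_sign_interval //.
  by rewrite rmorph_sum; apply: eq_bigr => A _; rewrite rmorphXn rmorphN1.
rewrite (eq_bigr _ sumA) (bigD1 B) //= eqxx mulr1 big1 ?addr0 => [|C].
  by rewrite /t exprMn.
by case/andP=> _; rewrite eq_sym => /negPf->; rewrite mulr0.
Qed.

Lemma sum_subtype_sets (R : nmodType) (X : finType) (D : {set X})
    (F : {set X} -> R) :
  \sum_(A : {set {x : X | x \in D}}) F [set val x | x in A]
    = \sum_(B : {set X} | B \subset D) F B.
Proof.
rewrite [RHS](reindex_onto (fun A : {set {x : X | x \in D}} => val @: A)
                (fun B => val @^-1: B)) /=.
  apply: eq_bigl => A; apply/esym/andP; split.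
    by apply/subsetP=> _ /imsetP[x _ ->]; apply: valP.
  by apply/eqP/setP=> x; rewrite inE mem_imset //; apply: val_inj.
move=> B /subsetP sBD; apply/setP=> x; apply/imsetP/idP => [[y]|xB].
  by rewrite inE => yB ->.
by exists (exist _ x (sBD x xB)); rewrite ?inE.
Qed.

Lemma sum_contr_sets (R : nmodType) (X : finType) (T : {set X})
    (F : {set X} -> R) :
  \sum_(A : {set contr_type T}) F (contr_set A :|: T)
    = \sum_(C : {set X} | T \subset C) F C.
Proof.
rewrite (sum_subtype_sets (~: T) (fun B => F (B :|: T))).
rewrite [RHS](reindex_onto (fun B => B :|: T) (fun C => C :\: T)) /=.
  apply: eq_bigl => B; rewrite subsetUr setDUl setDv setU0.
  by rewrite (sameP eqP setDidPl) disjoints_subset.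
by move=> C sTC; rewrite -{2}(setIidPr sTC) setUC setID.
Qed.

Lemma eval_atE (I : finType) (c : I -> int) (k : I -> nat) z :
  eval_at (\sum_i c i *: 'X^(k i)) z = \sum_i (c i)%:~R * z ^+ k i.
Proof.
rewrite /eval_at rmorph_sum horner_sum; apply: eq_bigr => i _.
by rewrite /= map_polyZ map_polyXn hornerZ hornerXn.
Qed.

Lemma eval_mchiE (X : finType) (M : mult_matroid X) z :
  eval_at (mchi M) z =
    \sum_(A : {set X})
      (-1) ^+ #|A| * (mult M A)%:R * z ^+ (rk M setT - rk M A).
Proof.
rewrite /mchi (eval_atE (fun A : {set X} => (-1) ^+ #|A| * (mult M A)%:Z)).
by apply: eq_bigr => A _; rewrite rmorphM rmorphXn rmorphN1 /= -pmulrn.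
Qed.

(** The factor [1] is the constant weight that matches [rank_convolution]. *)
Lemma eval_chiE (X : finType) (M : matroid X) z :
  eval_at (chi M) z =
    \sum_(A : {set X}) (-1) ^+ #|A| * 1 * z ^+ (rk M setT - rk M A).
Proof.
rewrite /chi (eval_atE (fun A : {set X} => (-1) ^+ #|A|)).
by apply: eq_bigr => A _; rewrite rmorphXn rmorphN1 mulr1.
Qed.

Lemma sum_restr (R : pzRingType) (X : finType) (M : matroid X) (A : {set X})
    (f : {set X} -> R) (z : R) :
  \sum_(B : {set restr_type A}) (-1) ^+ #|B| * f (restr_set B) *
      z ^+ (rk (restr A M) setT - rk (restr A M) B)
  = \sum_(B : {set X} | B \subset A)
      (-1) ^+ #|B| * f B * z ^+ (rk M A - rk M B).
Proof.
rewrite -sum_subtype_sets; apply: eq_bigr => B _.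
have restrT : restr_set [set: restr_type A] = A.
  apply/setP=> x; apply/imsetP/idP => [[y _ ->]|xA]; first exact: valP.
  by exists (exist _ x xA).
by rewrite /= /restr_rk restrT card_imset //; apply: val_inj.
Qed.

Lemma sum_contr (R : pzRingType) (X : finType) (M : matroid X) (A : {set X})
    (g : {set X} -> R) (z : R) :
  \sum_(B : {set contr_type A}) (-1) ^+ #|B| * g (contr_set B :|: A) *
      z ^+ (rk (contr A M) setT - rk (contr A M) B)
  = \sum_(C : {set X} | A \subset C)
      (-1) ^+ #|C :\: A| * g C * z ^+ (rk M setT - rk M C).
Proof.
rewrite -sum_contr_sets; apply: eq_bigr => B _.
have contrT : contr_set [set: contr_type A] :|: A = setT.
  apply/setP=> x; rewrite !inE orbC; case: (boolP (x \in A)) => //= xA.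
  have xC : x \in ~: A by rewrite inE.
  by apply/imsetP; exists (exist _ x xC).
have -> : #|(contr_set B :|: A) :\: A| = #|B|.
  rewrite setDUl setDv setU0 -[RHS](card_imset _ val_inj); congr #|pred_of_set _|.
  apply/setDidPl; rewrite disjoints_subset; apply/subsetP=> _ /imsetP[y _ ->].
  exact: valP.
(* The two truncated subtractions of [rk M A] cancel, as [A] lies in both sets. *)
by rewrite /= /contr_rk contrT subnBA ?rk_mono ?subsetUr // subnK ?rk_mono ?subsetT.
Qed.

Theorem theorem2p7 (X : finType) (M : mult_matroid X) (hM : arithmetic M) :
  eval_at (mchi M) (lambda * xi) =
    \sum_(A : {set X}) lambda ^+ (rk M setT - rk M A) *
      eval_at (mchi (mrestr A M)) lambda * eval_at (chi (contr A M)) xi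
  /\
  eval_at (mchi M) (lambda * xi) =
    \sum_(A : {set X}) lambda ^+ (rk M setT - rk M A) *
      eval_at (chi (restr A M)) lambda * eval_at (mchi (mcontr A M)) xi.
Proof.
pose m (A : {set X}) : {poly {poly int}} := (mult M A)%:R.
pose one (A : {set X}) : {poly {poly int}} := 1.
split; rewrite eval_mchiE.
- transitivity (\sum_(A : {set X}) (-1) ^+ #|A| * m A * one A *
      (lambda * xi) ^+ (rk M setT - rk M A)).
    by apply: eq_bigr => A _; rewrite mulr1.
  rewrite -rank_convolution; apply: eq_bigr => A _.
  by rewrite eval_mchiE eval_chiE -sum_restr -sum_contr.
- transitivity (\sum_(A : {set X}) (-1) ^+ #|A| * one A * m A *
      (lambda * xi) ^+ (rk M setT - rk M A)).
    by apply: eq_bigr => A _; rewrite mulr1.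
  rewrite -rank_convolution; apply: eq_bigr => A _.
  by rewrite eval_mchiE eval_chiE -sum_restr -sum_contr.
Qed.
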